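(* For all integers $m$ and $k$, the group $J_4(m,k)=\langle t,y\mid t^4,\ y^{m-k}t^3y^kt^2\rangle$ is isomorphic to $F^{m,k,m-k}$. For all integers $m$ and $k$, the group $J_6(m,k)=\langle t,y\mid t^6,\ y^{m-k}t^3y^kt^2\rangle$ has a presentation $\langle R,S\mid R^2,\ RS^m(RS^kRS^{m-k})^2\rangle$.
   Context: For integers $a,b,c$, $F^{a,b,c}$ denotes the group with presentation $\langle R,S\mid R^2,\ RS^aRS^bRS^c\rangle$. *)

(* Defs.v *)
From HB Require Import structures.
From mathcomp Require Import all_boot all_order all_algebra.
From mathcomp Require Import boolp.

Set Implicit Arguments.
Unset Strict Implicit.
Unset Printing Implicit Defensive.

Local Open Scope group_scope.

(* Integer powers; monoid.v only has the natural powers x ^+ n and x ^- n. *)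
Definition expgz (G : baseGroupType) (x : G) (n : int) : G :=
  match n with
  | Posz k => x ^+ k
  | Negz k => x ^- k.+1
  end.

Notation "x ^^ n" := (expgz x n) (at level 29, left associativity) : group_scope.

(* Unreduced words in the letters x and x^-1, x \in X: the pair (x, false)
   stands for x and (x, true) for x^-1. They form the free monoid with
   involution on X, in which w * w^-1 = 1 does not hold yet. *)
Definition word (X : choiceType) := seq (X * bool).

HB.instance Definition _ (X : choiceType) := Choice.on (word X).

Definition letter (X : choiceType) (x : X) : word X := [:: (x, false)].

Definition word_mul (X : choiceType) (u v : word X) : word X := u ++ v.

Definition word_inv (X : choiceType) (u : word X) : word X :=
  rev [seq (a.1, ~~ a.2) | a <- u].

Lemma word_mulA (X : choiceType) : associative (@word_mul X).
Proof. exact: catA. Qed.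

Lemma word_mul1 (X : choiceType) : left_id [::] (@word_mul X).
Proof. by []. Qed.

Lemma word_invK (X : choiceType) : involutive (@word_inv X).
Proof.
move=> u; rewrite /word_inv map_rev revK -map_comp -[RHS]map_id.
by apply: eq_map => -[x b] /=; rewrite negbK.
Qed.

Lemma word_invM (X : choiceType) :
  {morph @word_inv X : u v / word_mul u v >-> word_mul v u}.
Proof. by move=> u v; rewrite /word_inv /word_mul map_cat rev_cat. Qed.

HB.instance Definition _ (X : choiceType) := isStarMonoid.Build (word X)
  (@word_mulA X) (@word_mul1 X) (@word_invK X) (@word_invM X).

(* The least congruence on words whose quotient is a group in which every
   relator is trivial. *)
Inductive pres_cong (X : choiceType) (rels : seq (word X)) :
    word X -> word X -> Prop :=
| pres_refl u : pres_cong rels u u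
| pres_sym u v : pres_cong rels u v -> pres_cong rels v u
| pres_trans u v w :
    pres_cong rels u v -> pres_cong rels v w -> pres_cong rels u w
| pres_mul u u' v v' :
    pres_cong rels u u' -> pres_cong rels v v' -> pres_cong rels (u * v) (u' * v')
| pres_cancel u : pres_cong rels (u * u^-1) 1
| pres_rel r : r \in rels -> pres_cong rels r 1.

(* Classical boolean view of pres_cong, as generic_quotient needs a rel. *)
Definition pres_rel_bool (X : choiceType) (rels : seq (word X)) : rel (word X) :=
  fun u v => `[< pres_cong rels u v >].

Lemma pres_rel_bool_refl (X : choiceType) (rels : seq (word X)) :
  reflexive (pres_rel_bool rels).
Proof. by move=> u; apply/asboolP; apply: pres_refl. Qed.

Lemma pres_rel_bool_sym (X : choiceType) (rels : seq (word X)) :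
  symmetric (pres_rel_bool rels).
Proof. by move=> u v; apply/asboolP/asboolP; apply: pres_sym. Qed.

Lemma pres_rel_bool_trans (X : choiceType) (rels : seq (word X)) :
  transitive (pres_rel_bool rels).
Proof.
by move=> v u w /asboolP uv /asboolP vw; apply/asboolP; apply: pres_trans vw.
Qed.

Definition pres_equiv (X : choiceType) (rels : seq (word X)) :=
  EquivRel (pres_rel_bool rels) (@pres_rel_bool_refl X rels)
    (@pres_rel_bool_sym X rels) (@pres_rel_bool_trans X rels).

Definition pres (X : choiceType) (rels : seq (word X)) : Type :=
  {eq_quot (pres_equiv rels)}%qT.

HB.instance Definition _ (X : choiceType) (rels : seq (word X)) :=
  Choice.on (pres rels).

Definition pres_class (X : choiceType) (rels : seq (word X)) (u : word X) :
  pres rels := (\pi_{eq_quot (pres_equiv rels)} u)%qT.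

Definition pres_repr (X : choiceType) (rels : seq (word X)) (a : pres rels) :
  word X := repr (a : {eq_quot (pres_equiv rels)}%qT).

Lemma pres_reprK (X : choiceType) (rels : seq (word X)) (a : pres rels) :
  pres_class rels (pres_repr a) = a.
Proof. exact: reprK. Qed.

Lemma pres_classP (X : choiceType) (rels : seq (word X)) (u v : word X) :
  pres_class rels u = pres_class rels v <-> pres_cong rels u v.
Proof.
by split=> [/eqquotP/asboolP | uv] //; apply/eqquotP/asboolP.
Qed.

Lemma pres_class_repr (X : choiceType) (rels : seq (word X)) (u : word X) :
  pres_cong rels (pres_repr (pres_class rels u)) u.
Proof. by apply/pres_classP; rewrite pres_reprK. Qed.

Definition pres_gmul (X : choiceType) (rels : seq (word X)) (a b : pres rels) :=
  pres_class rels (pres_repr a * pres_repr b).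

Definition pres_gone (X : choiceType) (rels : seq (word X)) : pres rels :=
  pres_class rels 1.

Definition pres_ginv (X : choiceType) (rels : seq (word X)) (a : pres rels) :=
  pres_class rels (pres_repr a)^-1.

Lemma pres_gmulA (X : choiceType) (rels : seq (word X)) :
  associative (@pres_gmul X rels).
Proof.
move=> a b c; apply/pres_classP.
apply: (@pres_trans _ _ _ (pres_repr a * (pres_repr b * pres_repr c))).
  by apply: pres_mul (pres_class_repr _ _); apply: pres_refl.
rewrite mulgA; apply: pres_sym.
by apply: pres_mul (pres_class_repr _ _) _; apply: pres_refl.
Qed.

Lemma pres_gmul1g (X : choiceType) (rels : seq (word X)) :
  left_id (pres_gone rels) (@pres_gmul X rels).
Proof.
move=> a; rewrite -[RHS]pres_reprK; apply/pres_classP.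
rewrite -[X in pres_cong _ _ X]mul1g.
by apply: pres_mul (pres_class_repr _ _) _; apply: pres_refl.
Qed.

Lemma pres_gmulg1 (X : choiceType) (rels : seq (word X)) :
  right_id (pres_gone rels) (@pres_gmul X rels).
Proof.
move=> a; rewrite -[RHS]pres_reprK; apply/pres_classP.
rewrite -[X in pres_cong _ _ X]mulg1.
by apply: pres_mul (pres_class_repr _ _); apply: pres_refl.
Qed.

Lemma pres_gmulVg (X : choiceType) (rels : seq (word X)) :
  left_inverse (pres_gone rels) (@pres_ginv X rels) (@pres_gmul X rels).
Proof.
move=> a; apply/pres_classP; set u := pres_repr a.
apply: (@pres_trans _ _ _ (u^-1 * (u^-1)^-1)); last exact: pres_cancel.
by rewrite invgK; apply: pres_mul (pres_class_repr _ _) _; apply: pres_refl.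
Qed.

Lemma pres_gmulgV (X : choiceType) (rels : seq (word X)) :
  right_inverse (pres_gone rels) (@pres_ginv X rels) (@pres_gmul X rels).
Proof.
move=> a; apply/pres_classP; set u := pres_repr a.
apply: (@pres_trans _ _ _ (u * u^-1)); last exact: pres_cancel.
by apply: pres_mul (pres_class_repr _ _); apply: pres_refl.
Qed.

HB.instance Definition _ (X : choiceType) (rels : seq (word X)) :=
  isGroup.Build (pres rels) (@pres_gmulA X rels) (@pres_gmul1g X rels)
    (@pres_gmulg1 X rels) (@pres_gmulVg X rels) (@pres_gmulgV X rels).

Definition isomorphic (G H : groupType) : Prop :=
  exists f : {multiplicative G -> H}, bijective f.

Definition has_presentation (G : groupType) (X : choiceType)
    (rels : seq (word X)) : Prop :=
  isomorphic G (pres rels).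

(* Two-generator presentations: the relators are given as a function of the
   two (distinct) generators. *)
Definition rels2 (r : word bool -> word bool -> seq (word bool)) :
  seq (word bool) := r (letter false) (letter true).

Definition F (a b c : int) : groupType :=
  pres (rels2 (fun R S =>
    [:: R ^+ 2; R * S ^^ a * R * S ^^ b * R * S ^^ c])).

Definition J (n : nat) (m k : int) : groupType :=
  pres (rels2 (fun t y =>
    [:: t ^+ n; y ^^ (m - k)%R * t ^+ 3 * y ^^ k * t ^+ 2])).

(* pres_universal below: pres rels has the universal property that
   characterizes < X | rels >. *)

Definition word_eval (X : choiceType) (H : groupType) (g : X -> H)
    (u : word X) : H :=
  \prod_(a <- u) (if a.2 then (g a.1)^-1 else g a.1).

Lemma pres_classM (X : choiceType) (rels : seq (word X)) :
  {morph pres_class rels : u v / u * v}.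
Proof.
by move=> u v; apply/pres_classP; apply: pres_sym; apply: pres_mul;
  apply: pres_class_repr.
Qed.

Lemma pres_class_rel (X : choiceType) (rels : seq (word X)) r :
  r \in rels -> pres_class rels r = 1.
Proof. by move=> rr; apply/pres_classP; apply: pres_rel. Qed.

Lemma word_evalM (X : choiceType) (H : groupType) (g : X -> H) :
  {morph word_eval g : u v / u * v}.
Proof. by move=> u v; rewrite /word_eval big_cat. Qed.

Lemma word_evalV (X : choiceType) (H : groupType) (g : X -> H) :
  {morph word_eval g : u / u^-1}.
Proof.
move=> u; rewrite /word_eval -[u in RHS]revK -prodgV.
rewrite -[u^-1]/(rev _) -map_rev big_map.
by apply: eq_bigr => -[x []] _ /=; rewrite ?invgK.
Qed.

Lemma word_eval_cong (X : choiceType) (H : groupType) (rels : seq (word X))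
    (g : X -> H) (u v : word X) :
  {in rels, forall r, word_eval g r = 1} ->
  pres_cong rels u v -> word_eval g u = word_eval g v.
Proof.
move=> gr; elim=> {u v} //.
- by move=> u v w _ -> _ ->.
- by move=> u u' v v' _ Hu _ Hv; rewrite !word_evalM Hu Hv.
- by move=> u; rewrite word_evalM word_evalV mulgV /word_eval big_nil.
- by move=> r /gr ->; rewrite /word_eval big_nil.
Qed.

Lemma pres_universal (X : choiceType) (H : groupType) (rels : seq (word X))
    (g : X -> H) :
  {in rels, forall r, word_eval g r = 1} ->
  exists! f : pres rels -> H,
    {morph f : a b / a * b} /\
    forall x, f (pres_class rels (letter x)) = g x.
Proof.
move=> gr; exists (fun a => word_eval g (pres_repr a)); split.
  split=> [a b | x].
    by rewrite -word_evalM; apply: word_eval_cong (pres_class_repr _ _).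
  rewrite (word_eval_cong gr (pres_class_repr _ _)).
  by rewrite /word_eval big_seq1.
move=> f [fM fg]; apply/funext => a; rewrite -[in RHS](pres_reprK a).
have f1 : f 1 = 1 by apply: (mulgI (f 1)); rewrite -fM !mulg1.
have fV b : f b^-1 = (f b)^-1.
  by apply: (mulgI (f b)); rewrite -fM !mulgV.
elim: (pres_repr a) => [|[x b] u IHu]; first by rewrite /word_eval big_nil f1.
have -> : (x, b) :: u = ([:: (x, b)] : word X) * u by [].
rewrite word_evalM pres_classM fM -IHu; congr (_ * _).
rewrite /word_eval big_seq1 /=; case: b => //=; rewrite -fg // -fV.
congr f; apply: (mulgI (pres_class rels (letter x))).
rewrite mulgV -pres_classM; apply/pres_classP/pres_sym.
exact: (pres_cancel _ (letter x)).
Qed.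

(* Main.v *)
(* Write A = y^(m-k) and B = y^k, so that AB = BA = y^m. Since t^4 = 1, the second
   relator of J_4 says t = B t^2 A; hence t^2 and y generate, and eliminating t
   in favour of R = t^2 turns t^2 = R into (B R A)^2 = R, which up to inversion
   and cyclic rotation is the relator of F in R and S = y^-1. For J_6, put
   R = t^3: the second relator says t = R A R B, and t^3 = R becomes
   (R A R B)^3 = R, a cyclic rotation of the given relator with S = y. *)
Require Import Defs.
From HB Require Import structures.
From mathcomp Require Import all_boot all_order all_algebra.

Local Open Scope group_scope.

(** * Laws of integer exponents *)

Lemma expgz_subn (G : groupType) (x : G) (p q : nat) :
  x ^^ (p%:Z - q%:Z)%R = x ^+ p / x ^+ q.
Proof.
have [le_qp | lt_pq] := leqP q p; first by rewrite subzn //= expgnFr.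
(* [Negz n] is -(n+1), which accounts for the shift from q-p to q-p-1. *)
have -> : (p%:Z - q%:Z)%R = Negz (q - p.+1).
  by rewrite NegzE -subSn // subSS -GRing.opprB subzn // ltnW.
rewrite /= -subSn // subSS expgnFr ?(ltnW lt_pq) //.
by rewrite invgM invgK.
Qed.

(** Differences of naturals spare [expgzD] a case split on signs. *)
Lemma int_subn (n : int) : exists p q : nat, n = (p%:Z - q%:Z)%R.
Proof.
by case: n => p; [exists p, 0; rewrite GRing.subr0
                 | exists 0, p.+1; rewrite GRing.sub0r NegzE].
Qed.

Lemma expgzD (G : groupType) (x : G) (m n : int) :
  x ^^ (m + n)%R = x ^^ m * x ^^ n.
Proof.
have [p [q ->]] := int_subn m; have [r [s ->]] := int_subn n.
rewrite GRing.addrACA -GRing.opprD -!PoszD !expgz_subn.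
rewrite [(q + s)%N]addnC !expgnDr invgM -!mulgA; congr (_ * _).
by rewrite !mulgA; congr (_ * _); apply/commuteV/commuteX2.
Qed.

Lemma expgzV (G : groupType) (x : G) (n : int) : x^-1 ^^ n = (x ^^ n)^-1.
Proof. by case: n => n; rewrite /= expVgn. Qed.

(** * Evaluation of words and homomorphisms out of presentations *)

Lemma word_eval_letter (X : choiceType) (H : groupType) (g : X -> H) (x : X) :
  word_eval g (letter x) = g x.
Proof. exact: big_seq1. Qed.

Lemma word_evalX (X : choiceType) (H : groupType) (g : X -> H) (n : nat) :
  {morph word_eval g : u / u ^+ n}.
Proof.
move=> u; elim: n => [|n IHn]; first exact: big_nil.
by rewrite !expgS word_evalM IHn.
Qed.

Lemma word_evalXz (X : choiceType) (H : groupType) (g : X -> H) (n : int) :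
  {morph word_eval g : u / u ^^ n}.
Proof. by case: n => n u; rewrite /= ?word_evalV word_evalX. Qed.

(* [word_evalM] comes last, as it also matches unfolded numeral powers. *)
Definition word_evalE := (word_eval_letter, word_evalXz, word_evalX, word_evalV,
  word_evalM).

Section Presentations.

Variables (X : choiceType) (rels : seq (word X)).

Definition pres_gen (x : X) : pres rels := pres_class rels (letter x).

Lemma pres_classV : {morph pres_class rels : u / u^-1}.
Proof.
move=> u; apply/esym/mulg1_eq; rewrite -pres_classM.
exact/pres_classP/pres_cancel.
Qed.

Lemma pres_classE (u : word X) : pres_class rels u = word_eval pres_gen u.
Proof.
elim: u => [|[x b] u IHu]; first by rewrite /word_eval big_nil.
rewrite -[_ :: u]/(([:: (x, b)] : word X) * u) word_evalM pres_classM IHu.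
congr (_ * _); rewrite /word_eval big_seq1 /=; case: b => //.
by rewrite -pres_classV.
Qed.

Lemma pres_gen_rel r : r \in rels -> word_eval pres_gen r = 1.
Proof. by move=> rr; rewrite -pres_classE pres_class_rel. Qed.

(** Von Dyck's theorem with a bundled morphism, the form that [isomorphic] asks for. *)
Lemma pres_hom (H : groupType) (g : X -> H) :
  {in rels, forall r, word_eval g r = 1} ->
  exists f : {multiplicative pres rels -> H},
    forall u, f (pres_class rels u) = word_eval g u.
Proof.
move=> gr; pose f (a : pres rels) := word_eval g (pres_repr a).
have fE u : f (pres_class rels u) = word_eval g u.
  exact: word_eval_cong (pres_class_repr _ _).
have fM : {morph f : a b / a * b}.
  by move=> a b; rewrite -[a]pres_reprK -[b]pres_reprK -pres_classM !fE word_evalM.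
pose fm := isMultiplicative.Build (pres rels) H f fM.
pose F : {multiplicative pres rels -> H} := HB.pack f fm.
by exists F.
Qed.

End Presentations.

Arguments pres_gen {X} rels x.

Lemma eq_word_eval (X : choiceType) (H : groupType) (g h : X -> H) :
  g =1 h -> word_eval g =1 word_eval h.
Proof. by move=> gh u; apply: eq_bigr => a _; rewrite gh. Qed.

(** The product is the word that the substitution [s] makes of [u]; this computes composites of the
    maps given by [pres_hom]. *)
Lemma word_eval_comp (X Y : choiceType) (H : groupType) (h : Y -> H)
    (s : X -> word Y) (u : word X) :
  word_eval h (\prod_(a <- u) (if a.2 then (s a.1)^-1 else s a.1)) =
  word_eval (word_eval h \o s) u.
Proof.
rewrite [RHS]/word_eval (big_morph _ (word_evalM h) (big_nil _ _ _ _)).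
by apply: eq_bigr => -[x []] _ //=; rewrite word_evalV.
Qed.

(** Substitutions that respect the relators induce homomorphisms both ways. Their composites fix the
    generators, hence are identities. *)
Lemma pres_isomorphic (X Y : choiceType) (rX : seq (word X))
    (rY : seq (word Y)) (s : X -> word Y) (s' : Y -> word X) :
  {in rX, forall r, word_eval (word_eval (pres_gen rY) \o s) r = 1} ->
  {in rY, forall r, word_eval (word_eval (pres_gen rX) \o s') r = 1} ->
  (forall x, word_eval (word_eval (pres_gen rX) \o s') (s x) = pres_gen rX x) ->
  (forall y, word_eval (word_eval (pres_gen rY) \o s) (s' y) = pres_gen rY y) ->
  isomorphic (pres rX) (pres rY).
Proof.
move=> /pres_hom[f fE] /pres_hom[f' f'E] ss' s's; exists f.
exists f' => a; rewrite -[a]pres_reprK.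
  rewrite fE -word_eval_comp -pres_classE f'E word_eval_comp pres_classE.
  by apply: eq_word_eval => x; apply: ss'.
rewrite f'E -word_eval_comp -pres_classE fE word_eval_comp pres_classE.
by apply: eq_word_eval => y; apply: s's.
Qed.

(** One-sided inverses in a group are two-sided; this is the tool for rotating relators
    cyclically. *)
Lemma mulg_eq1C (G : groupType) (x y : G) : x * y = 1 -> y * x = 1.
Proof. by move=> /mulg1_eq <-; rewrite mulVg. Qed.

(** * Relator computations in an arbitrary group, with [A] and [B] for the powers of exponent m-k
    and k *)

Section RelatorEquivalence.

Variables (G : groupType) (t R A B : G).

Lemma J4_generator :
  t ^+ 4 = 1 -> A * t ^+ 3 * B * t ^+ 2 = 1 -> B * t ^+ 2 * A = t.
Proof.
move=> t4; have -> : t ^+ 3 = t^-1 by apply/esym/mulg1_eq; rewrite -expgS.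
rewrite -!mulgA => /mulg_eq1C; rewrite -!mulgA => /mulg1_eq.
by rewrite invgK => <-.
Qed.

(** This is the relator of F at R = t^2, S = y^-1. Squaring the second hypothesis gives (B R A)^2 =
    R; invert it, using R^-1 = R, and rotate. *)
Lemma J4_relator : t ^+ 4 = 1 -> B * t ^+ 2 * A = t ->
  t ^+ 2 * (A * B)^-1 * t ^+ 2 * B^-1 * t ^+ 2 * A^-1 = 1.
Proof.
move=> t4 tE.
have: t ^+ 2 * t ^+ 2 = 1 by rewrite -expgnDr.
have: B * t ^+ 2 * A * (B * t ^+ 2 * A) = t ^+ 2 by rewrite tE.
move: (t ^+ 2) => r rE rr; have rV := mulg1_eq rr.
have : (B * r * A * (B * r * A))^-1 = r by rewrite rE.
rewrite !invgM rV !mulgA => h.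
by apply: mulg_eq1C; rewrite !mulgA h.
Qed.

Hypothesis R2 : R ^+ 2 = 1.

Lemma F4_relatorV : R * (A * B) * R * B * R * A = 1 ->
  A^-1 * R * B^-1 * R * (A * B)^-1 * R = 1.
Proof.
by move/(congr1 (fun x => x^-1)) => /=; rewrite invg1 !invgM (mulg1_eq R2) !mulgA.
Qed.

(** Rotating A^-1 R to the end of the inverted relator gives (B^-1 R A^-1)^2 R = 1 = R R.
    Commutation lets (AB)^-1 be read as A^-1 B^-1. *)
Lemma F4_generator : commute A B ->
  R * (A * B) * R * B * R * A = 1 -> (B^-1 * R * A^-1) ^+ 2 = R.
Proof.
move=> cAB /F4_relatorV; rewrite cAB invgM => AB.
have /mulg_eq1C : A^-1 * R * (B^-1 * R * A^-1 * B^-1 * R) = 1.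
  by rewrite !mulgA in AB *.
by rewrite !mulgA => h; apply: (mulIg R); rewrite [RHS]R2 -h expgS expg1 !mulgA.
Qed.

(** This is the second relator of J_4 at t = B^-1 R A^-1, y = S^-1. Since t^2 = R, also t^3 = R t,
    and the inverted relator of F appears. *)
Lemma F4_relator : commute A B ->
  R * (A * B) * R * B * R * A = 1 -> (B^-1 * R * A^-1) ^+ 2 = R ->
  A^-1 * (B^-1 * R * A^-1) ^+ 3 * B^-1 * R = 1.
Proof.
move=> cAB /F4_relatorV <- tE.
by rewrite expgSr tE cAB invgM !mulgA.
Qed.

Lemma J6_generator :
  A * t ^+ 3 * B * t ^+ 2 = 1 -> t ^+ 3 * A * t ^+ 3 * B = t.
Proof.
(* After this multiplication the left side is t^3 times the relator, and the right side is t^3. *)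
move=> AB; apply: (mulIg (t ^+ 2)).
by rewrite -expgS -[RHS]mulg1 -AB !mulgA.
Qed.

(** Moving R B from the front to the end makes the block R A R B appear, which is the value of t. *)
Lemma F6_relator_cyclic :
  R * (B * A) * (R * B * R * A) ^+ 2 = 1 <->
  (A * R * B) * (R * A * R * B) ^+ 2 = 1.
Proof.
have expg2 (x : G) : x ^+ 2 = x * x by [].
rewrite !expg2 !mulgA.
split=> [h | h].
  have /mulg_eq1C : (R * B) * (A * R * B * R * A * R * B * R * A) = 1.
    by rewrite !mulgA.
  by rewrite !mulgA.
have /mulg_eq1C : (A * R * B * R * A * R * B * R * A) * (R * B) = 1.
  by rewrite !mulgA.
by rewrite !mulgA.
Qed.

End RelatorEquivalence.

Lemma expgz_split (G : groupType) (x : G) (m k : int) :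
  x ^^ (m - k)%R * x ^^ k = x ^^ m.
Proof. by rewrite -expgzD GRing.subrK. Qed.

Lemma expgz_comm (G : groupType) (x : G) (m n : int) :
  commute (x ^^ m) (x ^^ n).
Proof. by rewrite /commute -!expgzD GRing.addrC. Qed.

Theorem theorem1p1 :
  (forall m k : int, isomorphic (J 4 m k) (F m k (m - k)%R)) /\
  (forall m k : int,
     has_presentation (J 6 m k)
       (rels2 (fun R S =>
          [:: R ^+ 2; R * S ^^ m * (R * S ^^ k * R * S ^^ (m - k)%R) ^+ 2]))).
Proof.
split=> m k.
- rewrite /J /F; set rJ := rels2 _; set rF := rels2 _.
  (* [false] is the first generator and [true] the second. The image of t is B R A; since S = y^-1,
     the powers of y become inverses of powers of S. *)
  pose s b : word bool := let R := letter false in let S := letter true in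
    if b then S^-1 else (S ^^ k)^-1 * R * (S ^^ (m - k)%R)^-1.
  pose s' b : word bool := let t := letter false in let y := letter true in
    if b then y^-1 else t ^+ 2.
  pose t := pres_gen rJ false; pose y := pres_gen rJ true.
  pose R := pres_gen rF false; pose S := pres_gen rF true.
  have t4 : t ^+ 4 = 1.
    have := @pres_gen_rel _ rJ (letter false ^+ 4).
    by rewrite !word_evalE; apply; rewrite !inE eqxx.
  have tE : y ^^ k * t ^+ 2 * y ^^ (m - k)%R = t.
    apply: J4_generator => //.
    have := @pres_gen_rel _ rJ (letter true ^^ (m - k)%R * letter false ^+ 3 *
      letter true ^^ k * letter false ^+ 2).
    by rewrite !word_evalE; apply; rewrite !inE eqxx orbT.
  have R2 : R ^+ 2 = 1.
    have := @pres_gen_rel _ rF (letter false ^+ 2).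
    by rewrite !word_evalE; apply; rewrite !inE eqxx.
  have SE : R * S ^^ m * R * S ^^ k * R * S ^^ (m - k)%R = 1.
    have := @pres_gen_rel _ rF (letter false * letter true ^^ m * letter false *
      letter true ^^ k * letter false * letter true ^^ (m - k)%R).
    by rewrite !word_evalE; apply; rewrite !inE eqxx orbT.
  have RE : ((S ^^ k)^-1 * R * (S ^^ (m - k)%R)^-1) ^+ 2 = R.
    by apply: F4_generator => //; [apply: expgz_comm | rewrite expgz_split].
  apply: (@pres_isomorphic _ _ _ _ s s').
  + move=> r; rewrite !inE => /orP[] /eqP ->; rewrite !word_evalE /= !word_evalE.
      (* t^4 = (t^2)^2 = R^2. *)
      by rewrite -/R -/S (expgnA _ 2 2) RE.
    rewrite -/R -/S !expgzV RE.
    by apply: F4_relator => //; [apply: expgz_comm | rewrite expgz_split].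
  + move=> r; rewrite !inE => /orP[] /eqP ->; rewrite !word_evalE /= !word_evalE.
      by rewrite -/t -expgnA.
    by rewrite -/t -/y !expgzV -(expgz_split _ y m k); apply: J4_relator.
  + move=> [] /=; rewrite !word_evalE /= !word_evalE; first exact: invgK.
    by rewrite !expgzV !invgK.
  + move=> [] /=; rewrite !word_evalE /= !word_evalE; first exact: invgK.
    exact: RE.
- rewrite /has_presentation /J; set rJ := rels2 _; set rF := rels2 _.
  (* Here S = y, and t = R A R B is the equation [tE] below with R = t^3. *)
  pose s b : word bool := let R := letter false in let S := letter true in
    if b then S else R * S ^^ (m - k)%R * R * S ^^ k.
  pose s' b : word bool := let t := letter false in let y := letter true in
    if b then y else t ^+ 3.
  pose t := pres_gen rJ false; pose y := pres_gen rJ true.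
  pose R := pres_gen rF false; pose S := pres_gen rF true.
  have t6 : t ^+ 6 = 1.
    have := @pres_gen_rel _ rJ (letter false ^+ 6).
    by rewrite !word_evalE; apply; rewrite !inE eqxx.
  have tR : y ^^ (m - k)%R * t ^+ 3 * y ^^ k * t ^+ 2 = 1.
    have := @pres_gen_rel _ rJ (letter true ^^ (m - k)%R * letter false ^+ 3 *
      letter true ^^ k * letter false ^+ 2).
    by rewrite !word_evalE; apply; rewrite !inE eqxx orbT.
  have tE := @J6_generator _ _ _ _ tR.
  have R2 : R ^+ 2 = 1.
    have := @pres_gen_rel _ rF (letter false ^+ 2).
    by rewrite !word_evalE; apply; rewrite !inE eqxx.
  have SE : S ^^ (m - k)%R * R * S ^^ k *
      (R * S ^^ (m - k)%R * R * S ^^ k) ^+ 2 = 1.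
    apply/F6_relator_cyclic; rewrite expgz_comm expgz_split.
    have := @pres_gen_rel _ rF (letter false * letter true ^^ m * (letter false *
      letter true ^^ k * letter false * letter true ^^ (m - k)%R) ^+ 2).
    by rewrite !word_evalE; apply; rewrite !inE eqxx orbT.
  have RE : (R * S ^^ (m - k)%R * R * S ^^ k) ^+ 3 = R.
    (* R times the left side of [SE] is the cube of R A R B. *)
    by rewrite -[RHS]mulg1 -SE expgS !mulgA.
  apply: (@pres_isomorphic _ _ _ _ s s').
  + move=> r; rewrite !inE => /orP[] /eqP ->; rewrite !word_evalE /= !word_evalE.
      by rewrite -/R -/S (expgnA _ 3 2) RE.
    by rewrite -/R -/S RE.
  + move=> r; rewrite !inE => /orP[] /eqP ->; rewrite !word_evalE /= !word_evalE.
      by rewrite -/t -expgnA.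
    (* y^m is split as B A to match the cyclic form; [tE] then folds each block t^3 A t^3 B into t,
       leaving the relator [tR]. *)
    rewrite -/t -/y -(expgz_split _ y m k) -expgz_comm.
    apply/F6_relator_cyclic; rewrite tE.
    exact: tR.
  + by move=> [] /=; rewrite !word_evalE /= !word_evalE.
  + by move=> [] /=; rewrite !word_evalE /= !word_evalE.
Qed.
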